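(* Let $X$ be a topological space. (a) If $X$ is $C$-normal and every pseudocompact subspace of $X$ is contained in a compact subspace of $X$, then $X$ is $Ps$-normal. (b) If $X$ is $CC$-normal and every pseudocompact subspace of $X$ is contained in a countably compact subspace of $X$, then $X$ is $Ps$-normal.
   Context: A topological space is normal if any two disjoint closed subsets are contained in disjoint open sets (no $T_1$ assumption). A topological space is pseudocompact if every real-valued continuous function on it is bounded; a subset is called pseudocompact if it is pseudocompact in the subspace topology. No separation axiom is assumed in compactness, countable compactness or pseudocompactness. A space $X$ is $C$-normal (resp. $CC$-normal, $Ps$-normal) if there exist a normal space $Y$ and a bijection $f:X\to Y$ such that $f|_K:K\to f(K)$ is a homeomorphism (subspace topologies) for every compact (resp. countably compact, pseudocompact) subset $K$ of $X$. *)

(* Defs.v *)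
From HB Require Import structures.
From mathcomp Require Import all_boot all_order all_algebra.
From mathcomp Require Import all_classical all_reals all_analysis.

Set Implicit Arguments.
Unset Strict Implicit.
Unset Printing Implicit Defensive.

Import Order.TTheory GRing.Theory Num.Theory.
Import numFieldNormedType.Exports.

Local Open Scope classical_set_scope.
Local Open Scope ring_scope.

(* A countable open cover is given as a sequence of open sets; finite covers
   are covered by this, repeating a member or padding with set0. *)
Definition countably_compact (T : topologicalType) (A : set T) : Prop :=
  forall U : nat -> set T, (forall i, open (U i)) -> A `<=` \bigcup_i U i ->
    finite_subset_cover [set: nat] U A.

Definition pseudocompact_space (R : realType) (T : topologicalType) : Prop :=
  forall f : T -> R, continuous f -> bounded_fun f.

(* [set_type A] is the sigma type of the points of [A], with the topology
   initial for the inclusion, i.e. the subspace topology. *)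
Definition pseudocompact (R : realType) (T : topologicalType) (A : set T) :
    Prop :=
  pseudocompact_space R (set_type A).

Definition homeomorphism (S T : topologicalType) (h : S -> T) : Prop :=
  continuous h /\
  exists g : T -> S, [/\ cancel h g, cancel g h & continuous g].

Definition restrict_to_image (X Y : Type) (f : X -> Y) (K : set X)
    (x : set_type K) : set_type (f @` K) :=
  SigSub (mem_set (imageP f (set_valP x))).

(* [normal_space] makes no T1 assumption; by [normal_openP] it is the separation
   of disjoint closed sets by disjoint open sets. *)
Definition normal_relative_to (X : topologicalType) (P : set X -> Prop) :
    Prop :=
  exists (Y : topologicalType) (f : X -> Y),
    [/\ normal_space Y, bijective f &
      forall K : set X, P K -> homeomorphism (@restrict_to_image X Y f K)].

Definition C_normal (X : topologicalType) : Prop :=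
  normal_relative_to (@compact X).

Definition CC_normal (X : topologicalType) : Prop :=
  normal_relative_to (@countably_compact X).

Definition Ps_normal (R : realType) (X : topologicalType) : Prop :=
  normal_relative_to (@pseudocompact R X).

(* Main.v *)
Require Import Defs.
From mathcomp Require Import all_boot all_order all_algebra.
From mathcomp Require Import all_classical all_reals all_analysis.

Set Implicit Arguments.
Unset Strict Implicit.
Unset Printing Implicit Defensive.

Local Open Scope classical_set_scope.

(** A homeomorphism [K -> f(K)] restricts to a homeomorphism [A -> f(A)] for every subset [A] of
    [K]. So the space [Y] and the bijection [f] that witness C- or CC-normality also witness
    Ps-normality once each pseudocompact set lies in a compact (resp. countably compact) one. The
    weight is in [homeomorphism_restrict_subset]; [normal_relative_to_refine] then treats both parts
    at once. Since subspaces are distinct sigma types, inclusions appear as explicit maps. *)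

Definition subset_incl (T : Type) (A B : set T) (AB : A `<=` B)
    (x : set_type A) : set_type B :=
  SigSub (mem_set (AB _ (set_valP x))).

Lemma continuous_into_subspace (S T : topologicalType) (A : set T)
    (h : S -> set_type A) :
  continuous (fun x => set_val (h x)) -> continuous h.
Proof. exact: continuous_comp_initial. Qed.

Lemma set_val_continuous (T : topologicalType) (A : set T) :
  continuous (set_val : set_type A -> T).
Proof. exact: initial_continuous. Qed.

Lemma continuous_subset_incl (T : topologicalType) (A B : set T)
  (AB : A `<=` B) : continuous (subset_incl AB).
Proof. by apply: continuous_into_subspace; exact: set_val_continuous. Qed.

(** The inverse [g] on [f(K)] sends [f a] back to [a], hence maps [f(A)] into [A]; its corestriction
    is the inverse sought. *)
Lemma homeomorphism_restrict_subset (X Y : topologicalType) (f : X -> Y)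
    (A K : set X) : A `<=` K ->
  homeomorphism (@restrict_to_image X Y f K) ->
  homeomorphism (@restrict_to_image X Y f A).
Proof.
move=> AK [cK [g [fgK gfK cg]]].
have fAK : f @` A `<=` f @` K by exact: image_subset.
have gA (x : set_type A) :
    g (subset_incl fAK (restrict_to_image f x)) =
    subset_incl AK x.
  (* Both arguments of [g] are now the point [f x] of [f(K)], with different membership proofs. *)
  by rewrite -[RHS]fgK; congr (g _); exact: val_inj.
have gin (y : set_type (f @` A)) :
    set_val (g (subset_incl fAK y)) \in A.
  have [a Aa fay] := set_valP y.
  have -> : y = restrict_to_image f (SigSub (mem_set Aa)).
    by apply: val_inj; rewrite /= fay.
  by rewrite gA /=; exact: mem_set.
split.
  apply: continuous_into_subspace => x.
  (* After forgetting to [Y], the map is convertible to one factoring through [K], where [cK]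
     applies. *)
  apply: (@continuous_comp _ _ _
    (fun x => restrict_to_image f (subset_incl AK x)) set_val).
    apply: continuous_comp; [exact: continuous_subset_incl | exact: cK].
  exact: set_val_continuous.
exists (fun y => SigSub (gin y)); split => [x|y|].
- by apply: val_inj; rewrite /= gA.
- apply: val_inj => /=.
  by have /(congr1 set_val) := gfK (subset_incl fAK y).
- apply: continuous_into_subspace => y.
  apply: (@continuous_comp _ _ _
    (fun y => g (subset_incl fAK y)) set_val).
    apply: continuous_comp; [exact: continuous_subset_incl | exact: cg].
  exact: set_val_continuous.
Qed.

(** The same [Y] and [f] serve for every [A]; only the enclosing [K] varies. *)
Lemma normal_relative_to_refine (X : topologicalType) (P Q : set X -> Prop) :
  (forall A, Q A -> exists K, P K /\ A `<=` K) ->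
  normal_relative_to P -> normal_relative_to Q.
Proof.
move=> QP [Y [f [nY bf hf]]]; exists Y, f; split=> // A /QP[K [PK AK]].
by apply: (@homeomorphism_restrict_subset _ _ _ _ K) => //; exact: hf.
Qed.

Theorem theorem2p2 (R : realType) (X : topologicalType) :
  (C_normal X ->
   (forall A : set X, pseudocompact R A ->
      exists K : set X, compact K /\ A `<=` K) ->
   Ps_normal R X) /\
  (CC_normal X ->
   (forall A : set X, pseudocompact R A ->
      exists K : set X, countably_compact K /\ A `<=` K) ->
   Ps_normal R X).
Proof. by split=> nX sub; exact: normal_relative_to_refine sub nX. Qed.
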